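(* Let $p,l,M\ge 1$ and $d\ge 2$ be integers, let $r_0=l$, $r_d=1$, and let $r_1,\dots,r_{d-1}\ge 1$ be integers. Let $\boldsymbol{\mathcal{V}}^{(i)}\in\mathbb{R}^{r_{i-1}\times(pM+1)\times r_i}$, $i=1,\dots,d$, be 3-way real tensors (the TN-cores). Suppose the outputs $\boldsymbol{y}(t)=(y_1(t),\dots,y_l(t))^T\in\mathbb{R}^l$ are described by the MIMO Volterra system $$\boldsymbol{y}(t)=(\boldsymbol{\mathcal{V}}^{(1)}\times_2\boldsymbol{u}_t^T)\,(\boldsymbol{\mathcal{V}}^{(2)}\times_2\boldsymbol{u}_t^T)\cdots(\boldsymbol{\mathcal{V}}^{(d)}\times_2\boldsymbol{u}_t^T),$$ where $\boldsymbol{u}_t\in\mathbb{R}^{pM+1}$ is the input vector at time $t$. For $1\le k\le d-1$ set $$\boldsymbol{v}_{k-1}:=(\boldsymbol{\mathcal{V}}^{(1)}\times_2\boldsymbol{u}_t^T)\cdots(\boldsymbol{\mathcal{V}}^{(k-1)}\times_2\boldsymbol{u}_t^T)\in\mathbb{R}^{l\times r_{k-1}},$$ $$\boldsymbol{v}_{k+2}:=(\boldsymbol{\mathcal{V}}^{(k+2)}\times_2\boldsymbol{u}_t^T)\cdots(\boldsymbol{\mathcal{V}}^{(d)}\times_2\boldsymbol{u}_t^T)\in\mathbb{R}^{r_{k+1}\times 1},$$ and let $\boldsymbol{\mathcal{V}}^{(k,k+1)}\in\mathbb{R}^{r_{k-1}\times(pM+1)^2\times r_{k+1}}$ be the super-core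 with entries $$\boldsymbol{\mathcal{V}}^{(k,k+1)}_{i_1[i_2i_3]i_4}=\sum_{j=1}^{r_k}\boldsymbol{\mathcal{V}}^{(k)}_{i_1i_2j}\,\boldsymbol{\mathcal{V}}^{(k+1)}_{ji_3i_4}.$$ Then $$\boldsymbol{y}(t)=\big(\boldsymbol{v}_{k+2}^T\otimes(\boldsymbol{u}_t^T\otimes\boldsymbol{u}_t^T)\otimes\boldsymbol{v}_{k-1}\big)\,\mathrm{vec}(\boldsymbol{\mathcal{V}}^{(k,k+1)}).$$
   Context: The input vector is $$\boldsymbol{u}_t=\big(1,u_1(t),\dots,u_p(t),u_1(t-1),\dots,u_p(t-1),\dots,u_1(t-M+1),\dots,u_p(t-M+1)\big)^T\in\mathbb{R}^{pM+1},$$ where $u_1,\dots,u_p$ are real-valued discrete-time input signals, $p$ is the number of inputs, $l$ the number of outputs, $M$ the memory and $d$ the degree. For a 3-way tensor $\boldsymbol{\mathcal{A}}\in\mathbb{R}^{a\times n\times b}$ and $\boldsymbol{x}\in\mathbb{R}^n$, the 2-mode product $\boldsymbol{\mathcal{A}}\times_2\boldsymbol{x}^T$ is the $a\times 1\times b$ tensor, identified with an $a\times b$ matrix, with entries $\sum_{i=1}^n x_i\,\boldsymbol{\mathcal{A}}_{\alpha i\beta}$. Juxtaposition of such factors is matrix multiplication. An empty product is the identity matrix: for $k=1$, $\boldsymbol{v}_{0}=\boldsymbol{I}_l$, and for $k=d-1$, $\boldsymbol{v}_{d+1}=1$. In the super-core, $[i_2i_3]$ with $1\le i_2,i_3\le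 pM+1$ denotes a single multi-index in $\{1,\dots,(pM+1)^2\}$, namely $[i_2i_3]=i_2+(i_3-1)(pM+1)$ (column-major convention). $\otimes$ is the Kronecker product: $\boldsymbol{B}\otimes\boldsymbol{C}$ is the block matrix whose $(i,j)$ block is $b_{ij}\boldsymbol{C}$. The vectorization $\mathrm{vec}(\boldsymbol{\mathcal{A}})$ of a tensor lists all its entries in one column vector in column-major (Matlab) order, i.e. the first index varies fastest and the last index slowest. *)

(* Defs.v *)
From mathcomp Require Import all_boot all_order all_algebra.
From mathcomp Require Import reals.
From mathcomp Require Export mxtens.

Set Implicit Arguments.
Unset Strict Implicit.
Unset Printing Implicit Defensive.

Import GRing.Theory.
Local Open Scope ring_scope.

Definition tensor3 (R : Type) (a n b : nat) : Type := 'I_a -> 'I_n -> 'I_b -> R.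

Definition mode2_mul (R : realType) (a n b : nat)
    (A : tensor3 R a n b) (x : 'cV[R]_n) : 'M[R]_(a, b) :=
  \matrix_(alpha, beta) \sum_(i < n) x i 0 * A alpha i beta.

(* Column-major order: the entry (i1, i2, i3) has (0-based) position
   i1 + a * (i2 + n * i3), and [mxtens_index (i, j)] is i * q + j for j < q. *)
Definition vec (R : realType) (a n b : nat) (A : tensor3 R a n b) :
    'cV[R]_(b * n * a) :=
  \col_q let: (i32, i1) := mxtens_unindex q in
         let: (i3, i2) := mxtens_unindex i32 in A i1 i2 i3.

(* The merged index [i2 i3] is i2 + n * i3 (0-based), that is,
   [mxtens_index (i3, i2)]. *)
Definition supercore (R : realType) (a n b c : nat)
    (A : tensor3 R a n b) (B : tensor3 R b n c) : tensor3 R a (n * n) c :=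
  fun i1 i23 i4 =>
    let: (i3, i2) := mxtens_unindex i23 in
    \sum_(j < b) A i1 i2 j * B j i3 i4.

(* Signals are indexed by 'I_p and defined on all integer times.  Coordinate 0
   is the constant 1 and coordinate 1 + m * p + j is u_j (t - m). *)
Definition input_vector (R : realType) (p M : nat)
    (u : 'I_p -> int -> R) (t : int) : 'cV[R]_(p * M).+1 :=
  \col_i if unlift ord0 i is Some q then
           let: (m, j) := mxtens_unindex (cast_ord (mulnC p M) q) in
           u j (t - m%:Z)
         else 1.

(* (V^(a+1) x_2 x^T) ... (V^(b) x_2 x^T) for a <= b, where V i is the core
   V^(i), of size r (i - 1) * n * r i.  The value [pid_mx (r a)] is the identity
   matrix when a = b, see [core_prod_nil]; it avoids a cast from 'M_(r a) to
   'M_(r a, r b).  The case b < a is irrelevant. *)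
Fixpoint core_prod (R : realType) (n : nat) (r : nat -> nat)
    (V : forall i, tensor3 R (r i.-1) n (r i)) (x : 'cV[R]_n) (a b : nat) :
    'M[R]_(r a, r b) :=
  match b with
  | 0 => pid_mx (r a)
  | b'.+1 => if (a <= b')%N then core_prod V x a b' *m mode2_mul (V b'.+1) x
             else pid_mx (r a)
  end.

Lemma core_prod_nil (R : realType) (n : nat) (r : nat -> nat)
    (V : forall i, tensor3 R (r i.-1) n (r i)) (x : 'cV[R]_n) (a : nat) :
  core_prod V x a a = 1%:M.
Proof. by case: a => [|a] /=; rewrite ?ltnn pid_mx_1. Qed.

Lemma core_prod_rcons (R : realType) (n : nat) (r : nat -> nat)
    (V : forall i, tensor3 R (r i.-1) n (r i)) (x : 'cV[R]_n) (a b : nat) :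
  (a <= b)%N ->
  core_prod V x a b.+1 = core_prod V x a b *m mode2_mul (V b.+1) x.
Proof. by move=> /= ->. Qed.

(* Main.v *)
(** Every output factors as [v_(k-1) * S * v_(k+2)], where [S] is the product of
    the two middle factors, and [S] is the contraction of the super-core with
    [u_t *t u_t].  Expanding [v_(k-1) * S * v_(k+2)] over the positions of
    [vec] then gives the Kronecker row times the vectorized super-core. *)

Require Import Defs.
From mathcomp Require Import all_boot all_order all_algebra.
From mathcomp Require Import reals.
Import GRing.Theory.
Local Open Scope ring_scope.

Lemma sum_mxtens_index (V : nmodType) (m n : nat) (F : 'I_(m * n) -> V) :
  \sum_q F q = \sum_(i < m) \sum_(j < n) F (mxtens_index (i, j)).
Proof.
rewrite pair_bigA (reindex (@mxtens_index m n)) /=.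
  by apply: eq_bigr => -[].
by exists (@mxtens_unindex m n) => q _; rewrite (mxtens_indexK, mxtens_unindexK).
Qed.

Lemma core_prod_cat (R : realType) (n : nat) (r : nat -> nat)
    (V : forall i, tensor3 R (r i.-1) n (r i)) (x : 'cV[R]_n) (a b c : nat) :
  (a <= b)%N -> (b <= c)%N ->
  core_prod V x a c = core_prod V x a b *m core_prod V x b c.
Proof.
move=> leab; elim: c => [|c IHc].
  rewrite leqn0 => /eqP b0; rewrite {}b0 in leab *.
  by rewrite core_prod_nil mulmx1.
rewrite leq_eqVlt => /predU1P[<-|]; first by rewrite core_prod_nil mulmx1.
rewrite ltnS => lebc.
by rewrite !core_prod_rcons ?(leq_trans leab) // IHc // mulmxA.
Qed.

(** By bilinearity, the sum over the merged index splits into independent sums over [i2] and [i3].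
    The merged index has [i3] as its slow part, which is harmless because both Kronecker factors are
    the same [x]. *)
Lemma mode2_mul_supercore (R : realType) (a n b c : nat)
    (A : tensor3 R a n b) (B : tensor3 R b n c) (x : 'cV[R]_n) :
  mode2_mul (supercore A B) (x *t x) = mode2_mul A x *m mode2_mul B x.
Proof.
apply/matrixP => i k; rewrite !mxE sum_mxtens_index.
under eq_bigr => i3 _ do under eq_bigr => i2 _ do
  rewrite mxE /supercore !mxtens_indexK /= !(ord1 (Ordinal _)) mulr_sumr.
under [RHS]eq_bigr => j _ do rewrite !mxE big_distrlr /= exchange_big /=.
rewrite [RHS]exchange_big /=; apply: eq_bigr => i3 _.
rewrite [RHS]exchange_big /=; apply: eq_bigr => i2 _.
by apply: eq_bigr => j _; rewrite [RHS]mulrACA [x i2 0 * _]mulrC.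
Qed.

(** Three-way analogue of vec(L S w) = (w^T *t L) vec(S). The Kronecker factors appear in reverse
    order since [vec] lets the last tensor index vary slowest. *)
Lemma tens_mul_vec (R : realType) (l a n b : nat) (A : tensor3 R a n b)
    (L : 'M[R]_(l, a)) (x : 'cV[R]_n) (w : 'cV[R]_b) :
  L *m mode2_mul A x *m w =
  castmx (mul1n l, erefl) ((w^T *t x^T *t L) *m vec A).
Proof.
apply/matrixP => i j; rewrite ord1 castmxE.
have -> : cast_ord (esym (mul1n l)) i = mxtens_index (ord0, i).
  exact: val_inj.
rewrite !mxE !sum_mxtens_index; apply: eq_bigr => i3 _.
(* The factors [w^T] and [x^T] have a single row, so their row indices live in ['I_1] and collapse
   to 0. *)
under [RHS]eq_bigr => i2 _ do under eq_bigr => i1 _ do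
  rewrite mxE /vec mxE !mxtens_indexK !mxE !mxtens_indexK /= !(ord1 (Ordinal _)).
rewrite mxE mulr_suml exchange_big /=; apply: eq_bigr => i1 _.
rewrite mxE mulr_sumr mulr_suml; apply: eq_bigr => i2 _.
by rewrite mulrC !mulrA [w i3 0 * _ * x _ _]mulrAC.
Qed.

Theorem theorem4p2 (R : realType) (p l M d : nat)
  (hp : (1 <= p)%N) (hl : (1 <= l)%N) (hM : (1 <= M)%N) (hd : (2 <= d)%N)
  (r : nat -> nat) (r0 : r 0%N = l) (rd : r d = 1%N)
  (hr : forall i : nat, (1 <= i <= d.-1)%N -> (1 <= r i)%N)
  (V : forall i : nat, tensor3 R (r i.-1) (p * M).+1 (r i))
  (u : 'I_p -> int -> R) (y : int -> 'cV[R]_l)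
  (hy : forall t : int,
      y t = castmx (r0, rd) (core_prod V (input_vector M u t) 0 d))
  (k : nat) (hk : (1 <= k <= d.-1)%N) (t : int) :
  let ut : 'cV[R]_(p * M).+1 := input_vector M u t in
  let vl : 'M[R]_(l, r k.-1) := castmx (r0, erefl) (core_prod V ut 0 k.-1) in
  let vr : 'cV[R]_(r k.+1) := castmx (erefl, rd) (core_prod V ut k.+1 d) in
  y t = castmx (mul1n l, erefl)
          ((vr^T *t (ut^T *t ut^T) *t vl) *m vec (supercore (V k) (V k.+1))).
Proof.
(* Replacing [l] by [r 0] makes the casts along [r0] trivial; only the one along [rd] remains. *)
move=> ut vl vr; rewrite {}hy {}/vl {}/vr -/ut; subst l.
case: k hk => [//|k] /andP[_ hkd].
have ltkd : (k.+2 <= d)%N by rewrite -(ltn_predK hd).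
rewrite castmx_id -trmx_tens.
rewrite -[RHS](tens_mul_vec _ _ _ _ _ (supercore (V k.+1) (V k.+2))).
(* Cutting just after the two merged cores leaves the cast along [rd] on the right factor alone, as
   in [vr]. *)
rewrite (core_prod_cat _ _ _ _ _ 0 k.+2) // castmx_mul castmx_id.
by rewrite !core_prod_rcons // mode2_mul_supercore mulmxA.
Qed.
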